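(* Let $\mathcal C$ be a Clifford circuit on $n$ qubits with depth $\Delta$ and $m$ measurements, whose outcome code $\mathcal O(\mathcal C)$ is a linear code with parameters $[m,k]$. Then the set $\{\overleftarrow{F(u)}: u\in\mathcal O(\mathcal C)^\perp\}$ is a stabilizer group, i.e. it is a subgroup of $\overline{\mathcal P}_{N}$, $N=n(\Delta+1)$, whose elements pairwise commute and which (with suitable signs) does not contain $-I$; and the corresponding stabilizer code (the spacetime code $\mathcal Q(\mathcal C)$) has parameters $[[N,K]]$ with $N=n(\Delta+1)$ and $K=N-(m-k)$.
   Context: A Clifford circuit on $n$ qubits is a finite sequence of operations, each either a unitary Clifford gate or the measurement of a Hermitian $n$-qubit Pauli operator, each with a level in $\{1,2,\dots\}$; operations of equal level have disjoint supports and levels are nondecreasing along the sequence. The depth $\Delta$ is the maximal level. In circuit order the $j$-th measurement measures $S_j$ at level $\ell_j$ ($j=1,\dots,m$); outcome $o_j=0$ for eigenvalue $+1$, $1$ for $-1$. The outcome code $\mathcal O(\mathcal C)\subseteq\mathbb Z_2^m$ is the set of outcome bit-strings occurring with nonzero probability for some input state; $\mathcal O(\mathcal C)^\perp$ is its orthogonal complement for $(u|v)=\sum_iu_iv_i\bmod 2$. $\overline{\mathcal P}_N$ is the $N$-qubit Pauli group modulo phases $\{\pm1,\pm i\}$. For $1\le\ell\le\Delta$, $U_\ell$ is the product of all unitary gates of level $\ell$ (identity if none). A fault operator is $F\in\overline{\mathcal P}_{n(\Delta+1)}$ acting on qubits indexed by $(\ell+0.5,q)$, $\ell\in\{0,\dots,\Delta\}$,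 $q\in\{1,\dots,n\}$; $F_{\ell+0.5}\in\overline{\mathcal P}_n$ is its component on qubits $(\ell+0.5,\cdot)$. For $P\in\overline{\mathcal P}_n$, $\eta_{\ell+0.5}(P)$ is the fault operator equal to $P$ at level $\ell+0.5$ and $I$ elsewhere. The back-cumulant $\overleftarrow F$ is obtained by starting with $\overleftarrow F=F$ and, for $\ell=\Delta,\Delta-1,\dots,1$ in this order, replacing $\overleftarrow F_{\ell-0.5}$ by $\overleftarrow F_{\ell-0.5}\cdot U_\ell^{-1}\overleftarrow F_{\ell+0.5}U_\ell$. For $u\in\mathbb Z_2^m$, $F(u)=\prod_{j=1}^m\eta_{\ell_j-0.5}(S_j^{u_j})$.
   Formalization: Measured Paulis are required to be different from ±I, since measuring I makes K=N-(m-k) false (n=m=1, S=I gives k=0 but K=N); matrix entries and states are taken over the algebraic numbers, which covers every Clifford gate up to a global phase. *)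

(* Defs.v *)
From HB Require Import structures.
From mathcomp Require Import all_boot all_order all_algebra all_field.
From mathcomp Require Import boolp.
From Stdlib Require List.
Set Implicit Arguments. Unset Strict Implicit. Unset Printing Implicit Defensive.
Import Order.TTheory GRing.Theory Num.Theory.
Local Open Scope ring_scope.

(* Pauli group modulo phases: X^a Z^b is encoded by the pair (a, b). *)
Definition pauli (Q : finType) := ({ffun Q -> bool} * {ffun Q -> bool})%type.

Definition pid (Q : finType) : pauli Q := ([ffun=> false], [ffun=> false]).

Definition pmul (Q : finType) (p p' : pauli Q) : pauli Q :=
  ([ffun q => p.1 q (+) p'.1 q], [ffun q => p.2 q (+) p'.2 q]).

(* Hilbert space of the qubits Q has dimension 2^|Q|; basis index i encodes the
   bit string q |-> bit number (enum_rank q) of i. *)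
Definition qdim (Q : finType) := (2 ^ #|Q|)%N.
Definition qbit (Q : finType) (i : 'I_(qdim Q)) (q : Q) : bool :=
  odd (i %/ 2 ^ enum_rank q).

(* The matrix X^a Z^b :  |j> |-> (-1)^(b.j) |j xor a>. *)
Definition pmx (Q : finType) (p : pauli Q) : 'M[algC]_(qdim Q) :=
  \matrix_(i, j) (if [forall q, qbit i q == qbit j q (+) p.1 q]
                  then (-1) ^+ #|[set q | p.2 q && qbit j q]| else 0).

(* The Hermitian Pauli operator (-1)^s i^(a.b) X^a Z^b. *)
Definition hpmx (Q : finType) (s : bool) (p : pauli Q) : 'M[algC]_(qdim Q) :=
  ((-1) ^+ s * 'i ^+ #|[set q | p.1 q && p.2 q]|) *: pmx p.

Definition pcommute (Q : finType) (p p' : pauli Q) : bool :=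
  pmx p *m pmx p' == pmx p' *m pmx p.

(* U^{-1} P U  modulo phases (U Clifford): the Pauli p' with U^-1 P U = c P'. *)
Definition conjP (Q : finType) (U : 'M[algC]_(qdim Q)) (p : pauli Q) : pauli Q :=
  let M := invmx U *m pmx p *m U in
  odflt (pid Q) [pick p' : pauli Q |
     M == (\tr (invmx (pmx p') *m M) / (qdim Q)%:R) *: pmx p'].

(* Gate U S l : unitary gate U supported on the qubit set S, at level l.
   Meas s p l : measurement of the Hermitian Pauli hpmx s p, at level l. *)
Inductive op (n : nat) :=
| Gate of 'M[algC]_(qdim 'I_n) & {set 'I_n} & nat
| Meas of bool & pauli 'I_n & nat.

Definition op_level n (o : op n) : nat :=
  match o with Gate _ _ l => l | Meas _ _ l => l end.

Definition op_supp n (o : op n) : {set 'I_n} :=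
  match o with Gate _ T _ => T | Meas _ p _ => [set q | p.1 q || p.2 q] end.

Definition unitary_mx m (U : 'M[algC]_m) := U *m (map_mx Num.conj U)^T = 1%:M.

Definition clifford_mx (Q : finType) (U : 'M[algC]_(qdim Q)) :=
  forall p : pauli Q, exists p' : pauli Q, exists c : algC,
    invmx U *m pmx p *m U = c *: pmx p'.

Definition acts_within n (U : 'M[algC]_(qdim 'I_n)) (S : {set 'I_n}) :=
  forall p : pauli 'I_n, (forall q, q \in S -> ~~ p.1 q && ~~ p.2 q) ->
    U *m pmx p = pmx p *m U.

Definition op_ok n (o : op n) : Prop :=
  match o with
  | Gate U T _ => [/\ unitary_mx U, clifford_mx U & acts_within U T]
  | Meas _ p _ => p <> pid 'I_n
  end.

Definition op_dflt n : op n := Meas false (pid 'I_n) 0.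

Definition wf_circuit n (C : seq (op n)) : Prop :=
  [/\ forall o, Stdlib.Lists.List.In o C -> (1 <= op_level o)%N,
      sorted leq (map (@op_level n) C),
      forall o, Stdlib.Lists.List.In o C -> op_ok o &
      forall i j, (i < j < size C)%N ->
        op_level (nth (op_dflt n) C i) = op_level (nth (op_dflt n) C j) ->
        [disjoint op_supp (nth (op_dflt n) C i) & op_supp (nth (op_dflt n) C j)]].

Definition depth n (C : seq (op n)) : nat := \max_(o <- C) op_level o.

Definition meas n (C : seq (op n)) : seq (bool * pauli 'I_n * nat) :=
  pmap (fun o => match o with Meas s p l => Some (s, p, l) | _ => None end) C.

Definition nmeas n (C : seq (op n)) : nat := size (meas C).

Definition meas_dflt n : bool * pauli 'I_n * nat := (false, pid 'I_n, 0%N).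

Definition proj n (b s : bool) (p : pauli 'I_n) : 'M[algC]_(qdim 'I_n) :=
  2^-1 *: (1%:M + (-1) ^+ b *: hpmx s p).

(* the (unnormalized) operator applied by the circuit when the measurement
   number j, j+1, ... give outcomes o j, o (j+1), ... *)
Fixpoint run n (C : seq (op n)) (o : nat -> bool) (j : nat) : 'M[algC]_(qdim 'I_n) :=
  match C with
  | [::] => 1%:M
  | Gate U _ _ :: C' => run C' o j *m U
  | Meas s p _ :: C' => run C' o j.+1 *m proj (o j) s p
  end.

Definition obit m (o : 'rV['F_2]_m) (j : nat) : bool :=
  nth false [seq o 0 i != 0 | i <- enum 'I_m] j.

Definition outcome_prob n (C : seq (op n)) (o : 'rV['F_2]_(nmeas C))
    (psi : 'cV[algC]_(qdim 'I_n)) : algC :=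
  \sum_i `|(run C (obit o) 0 *m psi) i 0| ^+ 2.

Definition outcome_code n (C : seq (op n)) : {set 'rV['F_2]_(nmeas C)} :=
  [set o | `[< exists psi : 'cV[algC]_(qdim 'I_n),
               \sum_i `|psi i 0| ^+ 2 = 1 /\ outcome_prob o psi != 0 >]].

Definition dual_code m (O : {set 'rV['F_2]_m}) : {set 'rV['F_2]_m} :=
  [set u | [forall o in O, u *m o^T == 0]].

(* component index l : 'I_(depth).+1 stands for level l + 0.5 *)
Definition fault n (C : seq (op n)) := {ffun 'I_(depth C).+1 -> pauli 'I_n}.

Fixpoint ulevel n (C : seq (op n)) (l : nat) : 'M[algC]_(qdim 'I_n) :=
  match C with
  | [::] => 1%:M
  | Gate U _ l' :: C' => if l' == l then ulevel C' l *m U else ulevel C' l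
  | _ :: C' => ulevel C' l
  end.

(* F(u) = prod_j eta_{l_j - 0.5}(S_j^{u_j}) *)
Definition fault_of n (C : seq (op n)) (u : 'rV['F_2]_(nmeas C)) : fault C :=
  [ffun l : 'I_(depth C).+1 =>
     \big[@pmul _/pid 'I_n]_(j < nmeas C |
          (u 0 j != 0) && (((nth (meas_dflt n) (meas C) j).2).-1 == l :> nat))
        (nth (meas_dflt n) (meas C) j).1.2].

Fixpoint bcum_aux n (C : seq (op n)) (F : nat -> pauli 'I_n) (d l : nat) : pauli 'I_n :=
  match d with
  | 0 => F l
  | d'.+1 => pmul (F l) (conjP (ulevel C l.+1) (bcum_aux C F d' l.+1))
  end.

(* back-cumulant: for l = Delta, ..., 1, replace F_{l-0.5} by
   F_{l-0.5} . U_l^{-1} F_{l+0.5} U_l *)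
Definition back_cumulant n (C : seq (op n)) (F : fault C) : fault C :=
  let Fn (l : nat) := if insub l is Some l' then F l' else pid 'I_n in
  [ffun l : 'I_(depth C).+1 => bcum_aux C Fn (depth C - l) l].

Definition st_qubits n (C : seq (op n)) := ('I_(depth C).+1 * 'I_n)%type.

Definition flatten_fault n (C : seq (op n)) (F : fault C) : pauli (st_qubits C) :=
  ([ffun x : st_qubits C => (F x.1).1 x.2], [ffun x : st_qubits C => (F x.1).2 x.2]).

Definition spacetime_stab n (C : seq (op n)) : {set pauli (st_qubits C)} :=
  [set flatten_fault (back_cumulant (fault_of u)) | u in dual_code (outcome_code C)].

Definition stab_signs (Q : finType) (G : {set pauli Q}) (sg : pauli Q -> bool) : Prop :=
  (forall g h, g \in G -> h \in G ->
     exists2 f, f \in G & hpmx (sg g) g *m hpmx (sg h) h = hpmx (sg f) f) /\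
  (forall g, g \in G -> hpmx (sg g) g != - 1%:M).

Definition code_dim (Q : finType) (G : {set pauli Q}) (sg : pauli Q -> bool) : nat :=
  \rank (\bigcap_(g in G) kermx ((hpmx (sg g) g)^T - 1%:M))%MS.

(* Main.v *)
Require Import Defs.
From HB Require Import structures.
From mathcomp Require Import all_boot all_order all_algebra all_field.
From mathcomp Require Import boolp.
From mathcomp Require Import spectral mxabelem.
Import Order.TTheory GRing.Theory Num.Theory.
Set Implicit Arguments. Unset Strict Implicit. Unset Printing Implicit Defensive.
Local Open Scope ring_scope.

(** Write K_o for the operator applied by the circuit on outcomes o. If u is
    orthogonal to the outcome code, then (-1)^(u|o) = 1 whenever K_o <> 0, so the
    signed sum of the K_o^* K_o is the identity. Evaluated backwards through the
    circuit, this sum is a multiple of the back-propagation of F(u), and a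
    measurement of S annihilates it unless S commutes with the current operator.
    Hence the back-cumulant of F(u) commutes with every measured operator at the
    time of its measurement. So the commutator of the back-cumulants of F(u) and
    F(v) is the same at all levels, hence trivial since both are trivial after the
    last level. The map sending u to the back-cumulant of F(u) is linear, and
    injective because the Paulis measured at one level are nontrivial with disjoint
    supports, so the group has order 2^(m-k). Its signs are read off a common
    eigenvector, and the dimension of the code is the trace of its projector. *)

(** * Pauli matrices and the symplectic form *)

Section PauliMatrices.
Variable Q : finType.
Implicit Types (p q : pauli Q) (a b : {ffun Q -> bool}) (i j k : 'I_(qdim Q)).

Lemma pmulE p q : pmul p q = p + q. Proof. by []. Qed.

Lemma pidE : pid Q = 0. Proof. by []. Qed.

Lemma ffun_addbb a : a + a = 0.
Proof. by apply/ffunP => x; rewrite !ffunE; case: (a x). Qed.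

Lemma pauli_addpp p : p + p = 0.
Proof. by case: p => a b; congr (_, _); exact: ffun_addbb. Qed.

Lemma pauli_addKp p q : p + (p + q) = q.
Proof. by rewrite addrA pauli_addpp add0r. Qed.

Lemma pauli_eq0 p : (p == 0) = [forall x, ~~ p.1 x && ~~ p.2 x].
Proof.
apply/eqP/forallP => [-> x|p0]; first by rewrite !ffunE.
case: p p0 => a b p0; congr (_, _); apply/ffunP => x; rewrite ffunE;
  by have /= /andP[/negbTE ax /negbTE bx] := p0 x; rewrite ?ax ?bx.
Qed.

(** Here [bool] carries the structure of the field with two elements: the sum is an exclusive or and
    the product a conjunction. *)
Definition dot a b : bool := \sum_x (a x * b x).

Lemma dotC a b : dot a b = dot b a.
Proof. by apply: eq_bigr => x _; rewrite mulrC. Qed.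

Lemma dotDl a a' b : dot (a + a') b = dot a b + dot a' b.
Proof. by rewrite -big_split; apply: eq_bigr => x _; rewrite ffunE mulrDl. Qed.

Lemma dotDr a b b' : dot a (b + b') = dot a b + dot a b'.
Proof. by rewrite dotC dotDl ![dot _ a]dotC. Qed.

Lemma dot0l b : dot 0 b = 0.
Proof. by rewrite /dot big1 // => x _; rewrite ffunE mul0r. Qed.

Lemma odd_card_pred (P : pred Q) : odd #|[set x | P x]| = \sum_x (P x : bool).
Proof.
rewrite -sum1_card (big_morph odd oddD (erefl _)) big_mkcond.
by apply: eq_bigr => x _; rewrite inE; case: (P x).
Qed.

Lemma sign_card (R : pzRingType) (P : pred Q) :
  (-1) ^+ #|[set x | P x]| = (-1) ^+ ((\sum_x (P x : bool))%R : bool) :> R.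
Proof. by rewrite -odd_card_pred signr_odd. Qed.

Definition bits i : {ffun Q -> bool} := [ffun x => qbit i x].

Lemma eq_bits_nat (N m m' : nat) : (m < 2 ^ N)%N -> (m' < 2 ^ N)%N ->
  (forall r, (r < N)%N -> odd (m %/ 2 ^ r) = odd (m' %/ 2 ^ r)) -> m = m'.
Proof.
elim: N m m' => [|N IH] m m'; first by rewrite expn0 !ltnS !leqn0 => /eqP-> /eqP->.
rewrite !expnS => ltm ltm' eqm.
have /IH eq2 : (m./2 < 2 ^ N)%N by rewrite -divn2 ltn_divLR // mulnC.
have /eq2{}eq2 : (m'./2 < 2 ^ N)%N by rewrite -divn2 ltn_divLR // mulnC.
rewrite -(odd_double_half m) -(odd_double_half m') eq2.
  by have := eqm 0%N isT; rewrite expn0 !divn1 => ->.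
by move=> r lt_rN; have := eqm r.+1 lt_rN; rewrite expnS !divnMA !divn2.
Qed.

Lemma bits_inj : injective bits.
Proof.
move=> i j /ffunP eq_ij; apply/val_inj/(@eq_bits_nat #|Q|) => //= r ltr.
by have := eq_ij (enum_val (Ordinal ltr)); rewrite !ffunE /qbit enum_valK.
Qed.

Lemma bits_bij : bijective bits.
Proof. by apply: inj_card_bij bits_inj _; rewrite card_ffun card_bool card_ord. Qed.

Lemma pmxE p i j :
  pmx p i j = (bits i == bits j + p.1)%:R * (-1) ^+ dot p.2 (bits j).
Proof.
rewrite mxE (sign_card _ (fun x => p.2 x && qbit j x)).
have ->: [forall x, qbit i x == qbit j x (+) p.1 x] = (bits i == bits j + p.1).
  apply/forallP/eqP => [ij|/ffunP ij x].
    by apply/ffunP => x; rewrite !ffunE (eqP (ij x)).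
  by have := ij x; rewrite !ffunE => ->.
case: eqP => _; rewrite ?mul0r // mul1r; congr (_ ^+ _).
by congr nat_of_bool; apply: eq_bigr => x _; rewrite ffunE.
Qed.

Lemma pmxM p q : pmx p *m pmx q = (-1) ^+ dot p.2 q.1 *: pmx (p + q).
Proof.
case: bits_bij => unbits bitsK unbitsK.
apply/matrixP => i j; rewrite mxE [RHS]mxE.
(* Column [j] of [pmx q] has a single nonzero entry, in the row whose bit string is
   [bits j + q.1]. *)
rewrite (bigD1 (unbits (bits j + q.1))) //= big1 ?addr0 => [|k neq_k]; last first.
  rewrite !pmxE; case: (bits k =P _) => [eqk|]; last by rewrite mul0r mulr0.
  by case/negP: neq_k; rewrite -eqk bitsK.
rewrite !pmxE !unbitsK eqxx mul1r -mulrA [RHS]mulrCA; congr (_ * _).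
  by rewrite -addrA [q.1 + _]addrC.
rewrite -!signr_addb; congr (_ ^+ nat_of_bool _).
rewrite -[(p + q).2]/(p.2 + q.2) dotDr dotDl.
by move: (dot p.2 q.1) (dot p.2 _) (dot q.2 _) => [] [] [].
Qed.

Lemma pmx0 : pmx (0 : pauli Q) = 1%:M.
Proof. by apply/matrixP=> i j; rewrite pmxE /= dot0l addr0 (inj_eq bits_inj) mulr1 !mxE. Qed.

Lemma pmx_unit p : pmx p \in unitmx.
Proof.
have: pmx p *m pmx p = (-1) ^+ dot p.2 p.1 *: 1%:M by rewrite pmxM pauli_addpp pmx0.
move/(congr1 (mulmx^~ ((-1) ^+ dot p.2 p.1)%:M)).
rewrite -mulmxA mul_mx_scalar -scalemxAl mul1mx scale_scalar_mx -expr2 sqrr_sign.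
by case/mulmx1_unit.
Qed.

(** The symplectic form on phase-free Paulis: the sign produced by exchanging two Pauli matrices. *)
Definition symp p q : bool := dot p.2 q.1 + dot q.2 p.1.

Lemma sympC p q : symp p q = symp q p.
Proof. exact: addrC. Qed.

Lemma sympDl p p' q : symp (p + p') q = symp p q + symp p' q.
Proof. by rewrite /symp dotDl dotDr addrACA. Qed.

Lemma sympDr p q q' : symp p (q + q') = symp p q + symp p q'.
Proof. by rewrite sympC sympDl ![symp _ p]sympC. Qed.

Lemma symp0l q : symp 0 q = 0.
Proof. by rewrite /symp dot0l dotC dot0l addr0. Qed.

Lemma symppp p : symp p p = 0.
Proof. by rewrite /symp; case: (dot _ _). Qed.

Lemma sympE p q : symp p q = \sum_x (p.2 x * q.1 x + q.2 x * p.1 x).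
Proof. by rewrite big_split. Qed.

Lemma pmx_swap p q : pmx p *m pmx q = (-1) ^+ symp p q *: (pmx q *m pmx p).
Proof.
rewrite !pmxM scalerA -signr_addb [q + p]addrC; congr (_ *: _).
by rewrite /symp; move: (dot p.2 q.1) (dot q.2 p.1) => [] [].
Qed.

Lemma qdim_gt0 : (0 < qdim Q)%N. Proof. by rewrite expn_gt0. Qed.

Lemma qdimR_neq0 : (qdim Q)%:R != 0 :> algC.
Proof. by rewrite pnatr_eq0 -lt0n qdim_gt0. Qed.

Lemma scalar_neq0 (c : algC) p : (c *: pmx p == 0) = (c == 0).
Proof.
apply/eqP/eqP => [|->]; last by rewrite scale0r.
move/(congr1 (fun M => \tr (M *m invmx (pmx p)))).
rewrite -scalemxAl mulmxV ?pmx_unit // mul0mx linearZ /= mxtrace1 mxtrace0.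
by move/eqP; rewrite mulf_eq0 (negPf qdimR_neq0) orbF => /eqP.
Qed.

Lemma pcommuteE p q : pcommute p q = ~~ symp p q.
Proof.
rewrite /pcommute pmx_swap; case: (symp p q); last by rewrite scale1r eqxx.
rewrite expr1 scaleN1r -subr_eq0 -opprD oppr_eq0 -mulr2n -scaler_nat pmxM scalerA.
by rewrite scalar_neq0 mulf_eq0 pnatr_eq0 signr_eq0.
Qed.

(** Nondegeneracy of the symplectic form: at a qubit where [p] acts, take a single Z if [p] has an X
    part there, and a single X otherwise. *)
Lemma exists_anticommuting p : p != 0 -> exists q, symp p q.
Proof.
rewrite pauli_eq0 negb_forall => /existsP[x px].
have [p1x|p1x] := boolP (p.1 x).
  exists (0, [ffun y => y == x]); rewrite sympE (bigD1 x) //= big1 => [|y /negPf nyx].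
    by rewrite !ffunE eqxx p1x mulr0.
  by rewrite !ffunE nyx mulr0.
exists ([ffun y => y == x], 0); rewrite sympE (bigD1 x) //= big1 => [|y /negPf nyx].
  by move: px; rewrite !ffunE eqxx p1x negbK => ->.
by rewrite !ffunE nyx; case: (p.2 y).
Qed.

(** Conjugating a nontrivial Pauli by one that anticommutes with it negates the matrix but keeps the
    trace, so the trace vanishes. *)
Lemma mxtrace_pmx p : \tr (pmx p) = (p == 0)%:R * (qdim Q)%:R.
Proof.
have [->|/exists_anticommuting[q spq]] := eqVneq p 0.
  by rewrite pmx0 mxtrace1 mul1r.
rewrite mul0r; have /eqP := congr1 (fun M => \tr (M *m invmx (pmx q))) (pmx_swap p q).
rewrite spq expr1 scaleN1r mulmxK ?pmx_unit // mulNmx linearN /= mxtrace_mulC.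
by rewrite mulKmx ?pmx_unit // -addr_eq0 -mulr2n mulrn_eq0 => /eqP.
Qed.

(** Distinct Paulis are orthogonal for the trace form, so pairing both sides with [pmx p] separates
    them. *)
Lemma scale_pmx_inj (c d : algC) p q : c != 0 -> c *: pmx p = d *: pmx q -> p = q.
Proof.
move=> c0 /(congr1 (fun M => \tr (pmx p *m M))).
rewrite -!scalemxAr !pmxM !linearZ /= !mxtrace_pmx pauli_addpp eqxx mul1r => eqpq.
apply/eqP; suff: p + q == 0.
  by move/eqP/(congr1 (+%R p)); rewrite pauli_addKp addr0 => ->.
apply: contraNT c0 => /negPf pq0; move/eqP: eqpq.
by rewrite pq0 mul0r !mulr0 !mulf_eq0 signr_eq0 (negPf qdimR_neq0) !orbF.
Qed.

End PauliMatrices.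

(** * Stabilizer codes *)

(** In a full-rank factorization of A into columns times rows, idempotence forces rows times columns
    to be the identity of size rank A; the trace is cyclic. *)
Lemma rank_idempotent (F : fieldType) n (A : 'M[F]_n) :
  A *m A = A -> \tr A = (\rank A)%:R.
Proof.
move=> idA; have RC : row_base A *m col_base A = 1%:M.
  apply: (row_full_inj (col_base_full A)); apply: (row_free_inj (row_base_free A)).
  by rewrite /= mulmxA mulmx_base -mulmxA mulmx_base mulmx1 mulmx_base idA.
by rewrite -{1}(mulmx_base A) mxtrace_mulC RC mxtrace1.
Qed.

Section StabilizerGroups.
Variable Q : finType.
Implicit Types (p q g h : pauli Q) (G : {set pauli Q}).

Definition hphase (s : bool) p : algC := (-1) ^+ s * 'i ^+ #|[set x | p.1 x && p.2 x]|.

Lemma hphase_sq s p : hphase s p ^+ 2 = (-1) ^+ dot p.2 p.1.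
Proof.
rewrite exprMn sqrr_sign mul1r -exprM mulnC exprM sqrCi.
rewrite (sign_card _ (fun x => p.1 x && p.2 x)); congr (_ ^+ nat_of_bool _).
by apply: eq_bigr => x _; rewrite mulrC.
Qed.

Lemma hphase_neq0 s p : hphase s p != 0.
Proof. by rewrite mulf_neq0 ?signr_eq0 // expf_neq0 // neq0Ci. Qed.

Lemma hpmx_sq s p : hpmx s p *m hpmx s p = 1%:M.
Proof.
rewrite -scalemxAl -scalemxAr scalerA -expr2 hphase_sq pmxM scalerA.
by rewrite pauli_addpp pmx0 -expr2 sqrr_sign scale1r.
Qed.

Lemma hpmx_sign s p : hpmx s p = (-1) ^+ s *: hpmx false p.
Proof. by rewrite /hpmx expr0 mul1r scalerA. Qed.

Lemma hpmx_false0 : hpmx false (0 : pauli Q) = 1%:M.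
Proof.
rewrite /hpmx pmx0 mul1r (_ : [set _ | _] = set0) ?cards0 ?scale1r //.
by apply/setP => x; rewrite !inE !ffunE.
Qed.

Lemma hpmx_swap s t p q : hpmx s p *m hpmx t q = (-1) ^+ symp p q *: (hpmx t q *m hpmx s p).
Proof.
rewrite /hpmx -!scalemxAl -!scalemxAr pmx_swap !scalerA; congr (_ *: _).
by rewrite mulrC [X in _ * X]mulrC mulrA.
Qed.

Lemma scale_idmx_inj (c d : algC) : c *: 1%:M = d *: 1%:M :> 'M_(qdim Q) -> c = d.
Proof.
move/eqP; rewrite -subr_eq0 -scalerBl -pmx0 scalar_neq0 subr_eq0; exact: eqP.
Qed.

(** The product is a scalar multiple of [hpmx false (p + q)]. Since the factors commute it squares
    to the identity, so the scalar is 1 or -1. *)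
Lemma hpmxM_comm s t p q : pcommute p q ->
  exists r, hpmx s p *m hpmx t q = hpmx r (p + q).
Proof.
rewrite pcommuteE => /negPf pq.
pose M := hpmx s p *m hpmx t q.
have [c defM] : exists c, M = c *: hpmx false (p + q).
  exists (hphase s p * hphase t q * (-1) ^+ dot p.2 q.1 / hphase false (p + q)).
  rewrite /M /hpmx -!/(hphase _ _) -scalemxAl -scalemxAr pmxM !scalerA.
  by rewrite divfK ?hphase_neq0.
have : M *m M = 1%:M.
  rewrite {2}/M hpmx_swap pq scale1r mulmxA /M -[_ *m _ *m hpmx t q]mulmxA.
  by rewrite hpmx_sq mulmx1 hpmx_sq.
rewrite defM -scalemxAl -scalemxAr hpmx_sq scalerA -expr2 -[RHS]scale1r.
move/scale_idmx_inj/eqP; rewrite sqrf_eq1 => /orP[]/eqP cE.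
  by exists false; rewrite -/M defM cE scale1r.
by exists true; rewrite -/M defM cE [RHS]hpmx_sign.
Qed.

(** Commuting matrices share an eigenvector, and the signs are chosen so that every signed element
    fixes it. A product of fixing elements fixes it too, which makes the signs consistent. *)
Lemma exists_stab_signs G :
    {in G &, forall g h, g + h \in G} -> {in G &, forall g h, pcommute g h} ->
  exists sg, stab_signs G sg.
Proof.
move=> addG commG.
have commA : {in [seq hpmx false g | g <- enum G] &, forall A B, comm_mx A B}.
  move=> _ _ /mapP[g + ->] /mapP[h + ->]; rewrite !mem_enum => gG hG.
  have := commG _ _ gG hG; rewrite pcommuteE /comm_mx hpmx_swap => /negPf->.
  by rewrite scale1r.
have [v v0 /allP eigv] := common_eigenvector (qdim_gt0 Q) commA.
(* Each [hpmx false g] squares to the identity, so its eigenvalue on [v] is 1 or -1; the sign bit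
   records the second case. *)
pose sg g := v *m hpmx false g != v.
have fixv g : g \in G -> v *m hpmx (sg g) g = v.
  move=> gG; have /sub_rVP[a va] : (v *m hpmx false g <= v)%MS.
    by apply: eigv; apply: map_f; rewrite mem_enum.
  rewrite hpmx_sign -scalemxAr /sg; case: eqP => [->|]; first by rewrite scale1r.
  have := congr1 (mulmx v) (hpmx_sq false g).
  rewrite mulmxA va -scalemxAl va scalerA mulmx1 -{2}[v]scale1r => /eqP.
  rewrite -subr_eq0 -scalerBl scaler_eq0 (negPf v0) orbF subr_eq0 -expr2 sqrf_eq1.
  by case/orP=> /eqP->; rewrite !scaleN1r ?scale1r // opprK.
(* This rules out both a wrong sign in a product and the presence of -I. *)
have vNv : v <> - v.
  by move/eqP; rewrite -addr_eq0 -mulr2n -scaler_nat scaler_eq0 pnatr_eq0 (negPf v0).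
exists sg; split=> [g h gG hG|g gG].
  exists (g + h); first exact: addG.
  have [r ghE] := hpmxM_comm (sg g) (sg h) (commG _ _ gG hG).
  rewrite ghE; congr hpmx; have := congr1 (mulmx v) ghE.
  rewrite mulmxA !fixv // hpmx_sign -scalemxAr => vE.
  have := fixv _ (addG _ _ gG hG); rewrite hpmx_sign -scalemxAr => vE'.
  case: r (sg _) vE vE' {ghE} => [] [] //; rewrite expr1 expr0 scaleN1r scale1r => vE vE'.
    by case: vNv; rewrite {1}vE vE'.
  by case: vNv; rewrite {2}vE vE'.
by apply/eqP => /(congr1 (mulmx v)); rewrite fixv // mulmxN mulmx1 => /vNv.
Qed.

Lemma stab_mul G sg : stab_signs G sg ->
  {in G &, forall g h, g + h \in G /\
     hpmx (sg g) g *m hpmx (sg h) h = hpmx (sg (g + h)) (g + h)}.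
Proof.
case=> mulG _ g h gG hG; have [f fG ghE] := mulG _ _ gG hG.
suff <- : f = g + h by [].
move: ghE; rewrite /hpmx -!/(hphase _ _) -scalemxAl -scalemxAr pmxM !scalerA.
move/esym; apply: scale_pmx_inj; exact: hphase_neq0.
Qed.

(** The average of the signed group elements is the projector onto the code. Its rank equals its
    trace, to which only the identity contributes. *)
Lemma code_dim_stab G sg : 0 \in G -> stab_signs G sg ->
  (#|G| * code_dim G sg = qdim Q)%N.
Proof.
move=> G0 sgG; pose A g := hpmx (sg g) g.
have mulA g h : g \in G -> h \in G -> A g *m A h = A (g + h).
  by move=> gG hG; case: (stab_mul sgG gG hG).
(* The sign of the identity is forced, since [stab_signs] excludes -I. *)
have A0 : A 0 = 1%:M.
  have := (sgG.2 _ G0); rewrite /A hpmx_sign hpmx_false0.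
  by case: (sg 0); rewrite ?scale1r // scaleN1r eqxx.
have cardG0 : (#|G|)%:R != 0 :> algC by rewrite pnatr_eq0 -lt0n; apply/card_gt0P; exists 0.
pose P := (#|G|)%:R^-1 *: \sum_(g in G) A g.
have AP g : g \in G -> A g *m P = P.
  move=> gG; rewrite -scalemxAr; congr (_ *: _); rewrite mulmx_sumr.
  rewrite [RHS](reindex_inj (addrI g)) /=.
  rewrite (eq_bigl (fun h => g + h \in G)) => [|h].
    apply: eq_bigr => h ghG; apply: mulA => //.
    by have [] := stab_mul sgG gG ghG; rewrite pauli_addKp.
  apply/idP/idP => [hG|ghG]; first by have [] := stab_mul sgG gG hG.
  by have [] := stab_mul sgG gG ghG; rewrite pauli_addKp.
have PP : P *m P = P.
  rewrite {1}/P -scalemxAl mulmx_suml (eq_bigr (fun=> P)) => [|g]; last exact: AP.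
  by rewrite sumr_const -scaler_nat scalerA mulVf // scale1r.
(* Kernels consist of row vectors, so column vectors fixed by [A g] appear as rows fixed by its
   transpose. *)
have codeE : (\bigcap_(g in G) kermx ((A g)^T - 1%:M) :=: P^T)%MS.
  apply/eqmxP/andP; split.
    set W := (\bigcap_(g in G) _)%MS.
    have fixW g : g \in G -> W *m (A g)^T = W.
      move=> gG; apply/eqP; rewrite -subr_eq0 -[X in _ - X]mulmx1 -mulmxBr.
      by apply/eqP/sub_kermxP; exact: (sub_bigcapmxP (submx_refl W) g gG).
    suff <- : W *m P^T = W by exact: submxMl.
    rewrite linearZ /= linear_sum -scalemxAr mulmx_sumr.
    rewrite (eq_bigr (fun=> W)) => [|g]; last exact: fixW.
    by rewrite sumr_const -scaler_nat scalerA mulVf // scale1r.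
  apply/sub_bigcapmxP => g gG; apply/sub_kermxP.
  by rewrite mulmxBr mulmx1 -trmx_mul AP // subrr.
have trA : \sum_(g in G) \tr (A g) = (qdim Q)%:R.
  rewrite (bigD1 (0 : pauli Q)) //= big1 ?addr0 => [|g /andP[_ /negPf g0]].
    by rewrite A0 mxtrace1.
  by rewrite mxtraceZ mxtrace_pmx g0 mul0r mulr0.
apply/eqP; rewrite -(eqr_nat algC) natrM /code_dim codeE mxrank_tr -rank_idempotent //.
by rewrite mxtraceZ raddf_sum mulrA mulfV // mul1r; apply/eqP.
Qed.

End StabilizerGroups.

(** * Conjugation by Clifford unitaries *)

Section CliffordConjugation.
Variable Q : finType.
Implicit Types (p q : pauli Q) (U V : 'M[algC]_(qdim Q)).

Definition clifford_unit U := U \in unitmx /\ clifford_mx U.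

Lemma conj_mulmx U (A B : 'M[algC]_(qdim Q)) : U \in unitmx ->
  (invmx U *m A *m U) *m (invmx U *m B *m U) = invmx U *m (A *m B) *m U.
Proof. by move=> Uu; rewrite !mulmxA mulmxK. Qed.

Lemma conj_neq0 U p : U \in unitmx -> invmx U *m pmx p *m U != 0.
Proof.
move=> Uu; apply/eqP => /(congr1 (fun M => U *m M *m invmx U)).
rewrite !mulmxA mulmxV // mul1mx mulmxK // mulmx0 mul0mx => /eqP.
by rewrite -[pmx p]scale1r scalar_neq0 oner_eq0.
Qed.

(** The search in [conjP] succeeds because the scalar granted by [clifford_mx] is the normalized
    trace it tests for; the scalar is nonzero because conjugation is invertible. *)
Lemma conjP_spec U p : clifford_unit U ->
  exists2 c, c != 0 & invmx U *m pmx p *m U = c *: pmx (conjP U p).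
Proof.
case=> Uu /(_ p)[p' [c Up]]; have M0 := conj_neq0 p Uu.
rewrite /conjP; case: pickP => [p''/eqP eqM | /(_ p')] /=.
  rewrite {1}eqM; eexists; last by [].
  by move: M0; rewrite {1}eqM scalar_neq0.
rewrite Up -scalemxAr mulVmx ?pmx_unit // mxtraceZ mxtrace1.
by rewrite mulfK ?qdimR_neq0 // eqxx.
Qed.

Lemma conjP_eq U p q c : clifford_unit U -> c != 0 ->
  invmx U *m pmx p *m U = c *: pmx q -> conjP U p = q.
Proof.
move=> /(conjP_spec p)[d _ ->] c0 /esym Ep; apply/esym; exact: scale_pmx_inj Ep.
Qed.

Lemma conjPD U : clifford_unit U -> {morph conjP U : p q / p + q}.
Proof.
move=> CU p q; have [c c0 Ep] := conjP_spec p CU; have [d d0 Eq] := conjP_spec q CU.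
apply: (@conjP_eq _ _ _
  ((-1) ^+ dot p.2 q.1 * (c * d * (-1) ^+ dot (conjP U p).2 (conjP U q).1)) CU).
  by rewrite !mulf_neq0 ?signr_eq0.
have -> : pmx (p + q) = (-1) ^+ dot p.2 q.1 *: (pmx p *m pmx q).
  by rewrite pmxM scalerA -expr2 sqrr_sign scale1r.
rewrite -scalemxAr -scalemxAl -conj_mulmx ?CU.1 // Ep Eq.
by rewrite -scalemxAl -scalemxAr pmxM !scalerA !mulrA.
Qed.

(** Conjugating the exchange relation of [p] and [q] gives that of their images with the same
    sign. *)
Lemma symp_conjP U p q : clifford_unit U -> symp (conjP U p) (conjP U q) = symp p q.
Proof.
move=> CU; have [c c0 Ep] := conjP_spec p CU; have [d d0 Eq] := conjP_spec q CU.
have := congr1 (fun M => invmx U *m M *m U) (pmx_swap p q).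
rewrite -scalemxAr -scalemxAl -!conj_mulmx ?CU.1 // Ep Eq -!scalemxAl -!scalemxAr.
rewrite (pmx_swap (conjP U p)) pmxM !scalerA => /eqP.
rewrite -subr_eq0 -scalerBl scalar_neq0 mulrA -mulrBl mulf_eq0 signr_eq0 orbF.
rewrite -[X in _ - X]mulrA [d * c]mulrC [X in _ - X]mulrC -mulrBr.
rewrite !mulf_eq0 (negPf c0) (negPf d0) /= subr_eq0.
by rewrite (inj_eq (@signr_inj _)) => /eqP.
Qed.

Lemma clifford_unit1 : clifford_unit (1%:M : 'M_(qdim Q)).
Proof.
split=> [|p]; first exact: unitmx1.
by exists p, 1; rewrite invmx1 mul1mx mulmx1 scale1r.
Qed.

Lemma conjP1 p : conjP 1%:M p = p.
Proof.
apply: (conjP_eq clifford_unit1 (oner_neq0 _)).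
by rewrite invmx1 mul1mx mulmx1 scale1r.
Qed.

Lemma conj_comp U V p : clifford_unit U -> clifford_unit V ->
  exists2 c, c != 0 &
    invmx (V *m U) *m pmx p *m (V *m U) = c *: pmx (conjP U (conjP V p)).
Proof.
move=> CU CV; have [c c0 Ep] := conjP_spec p CV.
have [d d0 Eq] := conjP_spec (conjP V p) CU.
exists (c * d); first by rewrite mulf_neq0.
have -> : invmx (V *m U) = invmx U *m invmx V.
  have VUu : V *m U \in unitmx by rewrite unitmx_mul CV.1 CU.1.
  apply: (can_inj (mulKmx VUu)); rewrite mulmxV // mulmxA mulmxK ?CU.1 //.
  by rewrite mulmxV ?CV.1.
by rewrite -scalerA -Eq scalemxAl scalemxAr -Ep !mulmxA.
Qed.

Lemma clifford_unitM U V : clifford_unit U -> clifford_unit V -> clifford_unit (V *m U).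
Proof.
move=> CU CV; split=> [|p]; first by rewrite unitmx_mul CV.1 CU.1.
by have [c _ E] := conj_comp p CU CV; exists (conjP U (conjP V p)), c.
Qed.

Lemma conjPM U V p : clifford_unit U -> clifford_unit V ->
  conjP (V *m U) p = conjP U (conjP V p).
Proof.
move=> CU CV; have [c c0 E] := conj_comp p CU CV.
exact: (conjP_eq (clifford_unitM CU CV) c0 E).
Qed.

End CliffordConjugation.

Lemma conjP_acts_within n (U : 'M[algC]_(qdim 'I_n)) (T : {set 'I_n}) (p : pauli 'I_n) :
  clifford_unit U -> acts_within U T ->
  (forall q, q \in T -> ~~ p.1 q && ~~ p.2 q) -> conjP U p = p.
Proof.
move=> CU UT pT; apply: (conjP_eq CU (oner_neq0 _)).
by rewrite -mulmxA -UT // mulKmx ?CU.1 // scale1r.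
Qed.

(** * Back-propagation through a circuit *)

Section Circuits.
Variable n : nat.
Implicit Types (C : seq (op n)) (u v w : nat -> bool) (j l : nat) (p : pauli 'I_n).

(** A form of [wf_circuit] suited to induction: each operation is compared with all later ones. *)
Fixpoint circuit_ok C : Prop :=
  match C with
  | [::] => True
  | o :: C' =>
    [/\ op_ok o, (0 < op_level o)%N, all (fun o' => op_level o <= op_level o')%N C',
        all (fun o' => (op_level o' == op_level o) ==> [disjoint op_supp o & op_supp o']) C'
      & circuit_ok C']
  end.

Lemma wf_circuit_ok C : wf_circuit C -> circuit_ok C.
Proof.
elim: C => [|o C IH] //= [lev0 sortC okC disjC]; split.
- by apply: okC; left.
- by apply: lev0; left.
- have := order_path_min leq_trans sortC; by rewrite all_map.
- apply/(all_nthP (op_dflt n)) => i ltiC; apply/implyP => /eqP/esym.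
  by apply: (disjC 0%N i.+1); rewrite ltnS.
apply: IH; split=> [o' o'C||o' o'C|i i' /andP[ltii' lti'C]].
- by apply: lev0; right.
- exact: path_sorted sortC.
- by apply: okC; right.
- by apply: (disjC i.+1 i'.+1); rewrite !ltnS ltii'.
Qed.

Lemma gate_clifford (U : 'M[algC]_(qdim 'I_n)) T :
  [/\ unitary_mx U, clifford_mx U & acts_within U T] -> clifford_unit U.
Proof. by case=> /mulmx1_unit[]. Qed.

Lemma proj_swap b s p q : proj b s p *m pmx q = pmx q *m proj (b (+) symp p q) s p.
Proof.
rewrite /proj -scalemxAl -scalemxAr; congr (_ *: _).
rewrite mulmxDl mulmxDr mul1mx mulmx1; congr (_ + _).
rewrite -scalemxAl -scalemxAr /hpmx -scalemxAl -scalemxAr pmx_swap !scalerA.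
by congr (_ *: _); rewrite signr_addb -!mulrA; congr (_ * _); rewrite mulrA mulrC.
Qed.

Lemma projM b c s p : proj b s p *m proj c s p = if b == c then proj b s p else 0.
Proof.
rewrite /proj -scalemxAl -scalemxAr scalerA mulmxDl !mulmxDr !mul1mx !mulmx1.
rewrite -scalemxAl -scalemxAr hpmx_sq scalerA -signr_addb.
rewrite [X in _ + X]addrC addrACA -scalerDl -[X in X + _ *: _ + _]scale1r -scalerDl.
have two (a : algC) : a + a = 2 * a by rewrite mulr_natl mulr2n.
have [<-|] := eqVneq b c.
  rewrite addbb expr0 !two -!scalerA scale1r -scalerDr.
  by rewrite [_ *: (2 *: _)]scalerA mulVf ?pnatr_eq0 // scale1r.
by case: b c => [] [] // _; rewrite expr1 expr0 ?subrr ?addNr !scale0r addr0 scaler0.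
Qed.

Lemma proj_sum s p : \sum_(b : bool) proj b s p = 1%:M.
Proof.
rewrite big_bool /proj /= -scalerDr addrACA -scalerDl addNr scale0r addr0.
by rewrite -mulr2n -scaler_nat scalerA mulVf ?pnatr_eq0 // scale1r.
Qed.

Lemma proj_diff s p : proj false s p - proj true s p = hpmx s p.
Proof.
rewrite /proj /= -scalerBr opprD addrACA subrr add0r -scalerBl opprK.
by rewrite -mulr2n scalerA -mulr_natl mulr1 mulVf ?pnatr_eq0 // scale1r.
Qed.

(* The Heisenberg evolution of the identity through the circuit, weighted by the
   sign (-1)^(u.o) of the outcome string o. *)
Fixpoint heis C u j : 'M[algC]_(qdim 'I_n) :=
  match C with
  | [::] => 1%:M
  | Gate U _ _ :: C' => invmx U *m heis C' u j *m U
  | Meas s p _ :: C' =>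
      \sum_(b : bool) (-1) ^+ (u j && b) *: (proj b s p *m heis C' u j.+1 *m proj b s p)
  end.

Fixpoint parity C u (o : nat -> bool) j : bool :=
  match C with
  | [::] => false
  | Gate _ _ _ :: C' => parity C' u o j
  | Meas _ _ _ :: C' => (u j && o j) (+) parity C' u o j.+1
  end.

Lemma eq_run C o o' j : (forall i, (i < nmeas C)%N -> o (j + i)%N = o' (j + i)%N) ->
  run C o j = run C o' j.
Proof.
elim: C j => [|[U T l|s p l] C IH] j //= eqo; first by rewrite (IH j).
rewrite (IH j.+1) => [|i ltiC]; first by have := eqo 0%N isT; rewrite addn0 => ->.
by rewrite addSnnS; apply: eqo.
Qed.

Lemma parityE C u o j :
  parity C u o j = \sum_(i < nmeas C) (u (j + i)%N && o (j + i)%N : bool).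
Proof.
elim: C j => [|[U T l|s p l] C IH] j /=; first by rewrite big_ord0.
  exact: IH.
rewrite /nmeas /= big_ord_recl addn0 IH; congr (_ + _).
by apply: eq_bigr => i _; rewrite addSnnS.
Qed.

(** When the outcomes that survive on A all have the same parity, their sign factors out of the
    weighted sum and the completeness relation remains. The matrix A stands for the operations
    already performed: the induction moves each gate and projector into it. *)
Lemma heis_parity C u j (A : 'M[algC]_(qdim 'I_n)) c : circuit_ok C ->
    (forall o, run C o j *m A != 0 -> parity C u o j = c) ->
  heis C u j *m A = (-1) ^+ c *: A.
Proof.
elim: C j A c => [|[U T l|s p l] C IH] j A c /=.
- move=> _ /(_ xpred0); rewrite !mul1mx; have [->|_ /(_ isT) <-] := eqVneq A 0.
    by rewrite scaler0.
  by rewrite scale1r.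
- case=> /gate_clifford CU _ _ _ okC parC.
  rewrite -!mulmxA (IH _ _ c) // => [|o]; last by rewrite mulmxA; apply: parC.
  by rewrite -scalemxAr mulKmx ?CU.1.
case=> _ _ _ _ okC parC; rewrite mulmx_suml.
rewrite (eq_bigr (fun b => (-1) ^+ c *: (proj b s p *m A))) => [|b _].
  by rewrite -scaler_sumr -mulmx_suml proj_sum mul1mx.
rewrite -scalemxAl -!mulmxA (IH _ _ (c (+) (u j && b))) // => [|o runA].
  rewrite -scalemxAr scalerA mulmxA projM eqxx -signr_addb.
  by case: c (u j && b) {parC} => [] [].
(* Prescribing the outcome [b] at position [j] turns a string for the remaining circuit into one for
   the whole; the later positions are unaffected. *)
pose o' i := if i == j then b else o i.
have := parC o'; rewrite {2}/o' eqxx.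
have -> : run C o' j.+1 = run C o j.+1.
  by apply: eq_run => i _; rewrite /o' addSn -addnS -[X in _ == X]addn0 eqn_add2l.
rewrite -mulmxA => /(_ runA) <-.
have -> : parity C u o' j.+1 = parity C u o j.+1.
  rewrite !parityE; apply: eq_bigr => i _.
  by rewrite /o' addSn -addnS -[X in _ == X]addn0 eqn_add2l.
by rewrite /o' eqxx; case: (u j && b) (parity _ _ _ _) => [] [].
Qed.

(* The back-cumulant of F(u) restricted to operations of level > l, computed one
   operation at a time instead of one level at a time. *)
Fixpoint backprop C u j l : pauli 'I_n :=
  match C with
  | [::] => 0
  | Gate U _ l' :: C' =>
      if (l < l')%N then conjP U (backprop C' u j l) else backprop C' u j l
  | Meas _ p l' :: C' =>
      (if (l < l')%N && u j then p else 0) + backprop C' u j.+1 l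
  end.

Fixpoint meas_commute C u j : bool :=
  match C with
  | [::] => true
  | Gate _ _ _ :: C' => meas_commute C' u j
  | Meas _ p _ :: C' => ~~ symp p (backprop C' u j.+1 0) && meas_commute C' u j.+1
  end.

(** An anticommuting [q] exchanges the two projectors, and orthogonal projectors then meet. A
    commuting [q] factors out, leaving the sum or the difference of the projectors. *)
Lemma signed_meas_pmx (a : bool) s p q :
  \sum_(b : bool) (-1) ^+ (a && b) *: (proj b s p *m pmx q *m proj b s p) =
  if symp p q then 0 else pmx q *m (if a then hpmx s p else 1%:M).
Proof.
rewrite (eq_bigr (fun b => if symp p q then 0
                  else (-1) ^+ (a && b) *: (pmx q *m proj b s p))) => [|b _].
  case: (symp p q); first by rewrite big1.
  rewrite -(proj_diff s p) -(proj_sum s p) !big_bool /=; case: a => /=.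
    by rewrite expr1 scaleN1r scale1r mulmxBr addrC.
  by rewrite !scale1r mulmxDr.
rewrite proj_swap -mulmxA projM; case: (symp p q); last by rewrite addbF eqxx.
by case: b; rewrite /= mulmx0 scaler0.
Qed.

(** An anticommuting measurement would annihilate the operator for good, so a nonzero result
    certifies commutation at every measurement. Each step then keeps it a nonzero multiple of a
    Pauli. *)
Lemma heis_backprop C u j : circuit_ok C -> heis C u j != 0 ->
  meas_commute C u j /\ exists2 c, c != 0 & heis C u j = c *: pmx (backprop C u j 0).
Proof.
elim: C j => [|[U T l|s p l] C IH] j /=.
- by split=> //; exists 1; rewrite ?oner_eq0 // pmx0 scale1r.
- case=> /gate_clifford CU l0 _ _ okC nz; rewrite l0.
  have nz' : heis C u j != 0.
    by apply: contraNneq nz => ->; rewrite mulmx0 mul0mx.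
  have [-> [c c0 ->]] := IH j okC nz'; split=> //.
  have [d d0 Ed] := conjP_spec (backprop C u j 0) CU.
  by exists (c * d); rewrite ?mulf_neq0 // -scalemxAr -scalemxAl Ed scalerA.
case=> _ l0 _ _ okC nz; rewrite l0.
have nz' : heis C u j.+1 != 0.
  by apply: contraNneq nz => ->; rewrite big1 // => b _; rewrite mulmx0 mul0mx scaler0.
have [-> [c c0 hE]] := IH j.+1 okC nz'.
rewrite andbT; move: nz; set B := backprop C u j.+1 0 in hE *.
have -> : \sum_(b : bool) (-1) ^+ (u j && b) *: (proj b s p *m heis C u j.+1 *m proj b s p) =
    c *: \sum_(b : bool) (-1) ^+ (u j && b) *: (proj b s p *m pmx B *m proj b s p).
  rewrite scaler_sumr; apply: eq_bigr => b _.
  by rewrite hE -(scalemxAr c) -(scalemxAl c) !scalerA mulrC.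
rewrite signed_meas_pmx; case: symp; first by rewrite scaler0 eqxx.
move=> _; split=> //=; case: (u j); last by exists c; rewrite // mulmx1 add0r.
exists (c * (hphase s p * (-1) ^+ dot B.2 p.1)).
  rewrite (mulf_neq0 c0) //; apply: mulf_neq0; first exact: hphase_neq0.
  by rewrite signr_eq0.
by rewrite -scalemxAr pmxM !scalerA !mulrA [p + B]addrC.
Qed.

Lemma backprop_level C u j l l' : (l <= l')%N ->
  all (fun o => (l' < op_level o)%N) C -> backprop C u j l = backprop C u j l'.
Proof.
move=> le_ll'; elim: C j => [|[U T k|s p k] C IH] j //= /andP[lt_k ltC];
  by rewrite (leq_ltn_trans le_ll' lt_k) lt_k IH.
Qed.

(** Gates preserve the symplectic form, and a measurement multiplies in only a Pauli that commutes
    with both operators. *)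
Lemma symp_backprop C u v j l : circuit_ok C -> meas_commute C u j -> meas_commute C v j ->
  symp (backprop C u j l) (backprop C v j l) = false.
Proof.
elim: C j => [|[U T k|s p k] C IH] j //=; first by rewrite symp0l.
  case=> /gate_clifford CU _ _ _ okC cu cv; rewrite -(IH j okC cu cv).
  by case: ifP => // _; rewrite symp_conjP.
case=> _ _ kC _ okC /andP[pu cu] /andP[pv cv]; case: ltnP => [lt_lk|_] /=; last first.
  by rewrite !add0r; exact: IH.
(* Levels are nondecreasing, so past an operation of level above [l] the threshold is irrelevant and
   [meas_commute], stated at threshold 0, applies. *)
have low w : backprop C w j.+1 l = backprop C w j.+1 0.
  by apply/esym/backprop_level => //; apply: sub_all kC => o; exact: leq_trans.
rewrite !sympDl !sympDr (IH _ okC cu cv) !low [symp (backprop _ _ _ _) _]sympC.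
by case: (u j); case: (v j);
  rewrite ?symppp ?symp0l ?[symp _ 0]sympC ?symp0l ?(negPf pu) ?(negPf pv).
Qed.

Lemma backpropD C u v j l : circuit_ok C ->
  backprop C (fun i => u i (+) v i) j l = backprop C u j l + backprop C v j l.
Proof.
elim: C j => [|[U T k|s p k] C IH] j //=; first by rewrite addr0.
  by case=> /gate_clifford CU _ _ _ /IH->; case: ifP => // _; rewrite conjPD.
case=> _ _ _ _ /IH->; rewrite addrACA; congr (_ + _).
case: (_ < _)%N => /=; last by rewrite addr0.
by case: (u j); case: (v j); rewrite ?addr0 ?add0r ?pauli_addpp.
Qed.

(* F(u) at level l + 0.5 *)
Fixpoint layer C u j l : pauli 'I_n :=
  match C with
  | [::] => 0
  | Gate _ _ _ :: C' => layer C' u j l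
  | Meas _ p l' :: C' => (if (l' == l.+1) && u j then p else 0) + layer C' u j.+1 l
  end.

Lemma layer_disjoint C u j l (T : {set 'I_n}) x :
    all (fun o => (op_level o == l.+1) ==> [disjoint T & op_supp o]) C -> x \in T ->
  (layer C u j l).1 x = false /\ (layer C u j l).2 x = false.
Proof.
move=> + xT; elim: C j => [|[U S k|s p k] C IH] j /=; first by rewrite !ffunE.
  by case/andP=> _ /IH.
case/andP=> dT /(IH j.+1)[l1 l2]; rewrite !ffunE l1 l2.
case: eqP dT => [_|_] /= dT; last by rewrite !ffunE.
case: (u j); last by rewrite !ffunE.
by have := disjointFr dT xT; rewrite inE => /norP[/negPf-> /negPf->].
Qed.

Lemma layer_high C u j l : all (fun o => (l.+1 < op_level o)%N) C -> layer C u j l = 0.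
Proof.
elim: C j => [|[U T k|s p k] C IH] j //= /andP[lt_k ltC]; rewrite IH // addr0.
by rewrite gtn_eqF.
Qed.

Lemma ulevel_high C l : all (fun o => (l < op_level o)%N) C -> ulevel C l = 1%:M.
Proof.
elim: C => [|[U T k|s p k] C IH] //= /andP[lt_k ltC]; last exact: IH.
by rewrite gtn_eqF // IH.
Qed.

Lemma ulevel_clifford C l : circuit_ok C -> clifford_unit (ulevel C l).
Proof.
elim: C => [|[U T k|s p k] C IH] /=; first by move=> _; exact: clifford_unit1.
  case=> /gate_clifford CU _ _ _ /IH Cl; case: ifP => // _; exact: clifford_unitM.
by case=> _ _ _ _ /IH.
Qed.

(** The recursion that defines the back-cumulant. Gates and measurements of level [l.+1] may be
    interleaved in the sequence, but their disjoint supports let the measured Paulis pass through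
    the gates unchanged. *)
Lemma backprop_step C u j l : circuit_ok C ->
  backprop C u j l = layer C u j l + conjP (ulevel C l.+1) (backprop C u j l.+1).
Proof.
elim: C j => [|[U T k|s p k] C IH] j okC.
- by rewrite /= conjP1 add0r.
- case: (okC) => /= Uok _ kC dC okC'; have CU := gate_clifford Uok.
  have Cl := ulevel_clifford l.+1 okC'.
  rewrite /=; case: (ltngtP l.+1 k) => [lt_lk|lt_kl|eq_lk].
  + have hC : all (fun o => (l.+1 < op_level o)%N) C.
      by apply: sub_all kC => o; exact: leq_trans.
    rewrite layer_high // ulevel_high // conjP1 add0r.
    by rewrite (backprop_level _ _ (leqnSn l) hC).
  + by rewrite IH.
  (* The gate belongs to level [l.+1] itself: it joins the level unitary and must fix the layer of
     the later measurements. *)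
  rewrite IH // conjPM // conjPD //; congr (_ + _).
  apply: (conjP_acts_within CU (T := T)); first by case: Uok.
  move=> q qT; rewrite -eq_lk in dC.
  by have [-> ->] := @layer_disjoint C u j l T q dC qT.
case: (okC) => /= _ _ kC dC okC'.
case: (ltngtP l.+1 k) => [lt_lk|lt_kl|eq_lk] /=.
- have hC : all (fun o => (l.+1 < op_level o)%N) C.
    by apply: sub_all kC => o; exact: leq_trans.
  rewrite layer_high // ulevel_high // conjP1 !add0r.
  by rewrite (backprop_level _ _ (leqnSn l) hC).
- by rewrite !add0r IH.
by rewrite add0r IH // addrA.
Qed.

Lemma backprop_low C u j l : all (fun o => (op_level o <= l)%N) C -> backprop C u j l = 0.
Proof.
elim: C j => [|[U T k|s p k] C IH] j //= /andP[le_k leC]; rewrite ltnNge le_k /= IH //.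
by rewrite addr0.
Qed.

Lemma layer_low C u j l : all (fun o => (op_level o <= l)%N) C -> layer C u j l = 0.
Proof.
elim: C j => [|[U T k|s p k] C IH] j //= /andP[le_k leC]; rewrite IH // addr0.
by rewrite ltn_eqF.
Qed.

(** A measured Pauli is nontrivial at some qubit, which no later measurement of the same level
    touches; the layer at that qubit reveals the bit. *)
Lemma layer_inj C u v j : circuit_ok C -> (forall l, layer C u j l = layer C v j l) ->
  forall i, (i < nmeas C)%N -> u (j + i)%N = v (j + i)%N.
Proof.
elim: C j => [|[U T k|s p k] C IH] j //=.
  by case=> _ _ _ _ okC eql i; exact: IH.
case=> pid0 k0 _ dC okC eql.
have eq_j : u j = v j.
  have [x px] : exists x, p.1 x || p.2 x.
    apply/existsP; apply: contra_notT pid0; rewrite negb_exists => /forallP p0.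
    by apply/eqP; rewrite pidE pauli_eq0; apply/forallP => x; rewrite -negb_or.
  (* Layer [l] holds the measurements of level [l.+1], hence the predecessor. *)
  have := eql k.-1; rewrite prednK // eqxx /= => eqp.
  have dC' w := @layer_disjoint C w j.+1 k.-1 [set q | p.1 q || p.2 q] x.
  rewrite prednK // inE px in dC'.
  have [u1 u2] := dC' u dC isT; have [v1 v2] := dC' v dC isT.
  have := congr1 (fun r : pauli 'I_n => r.1 x || r.2 x) eqp.
  rewrite !ffunE u1 u2 v1 v2.
  by case: (u j); case: (v j); rewrite //= !ffunE; move: px; case: (p.1 x); case: (p.2 x).
case=> [|i] ltiC; first by rewrite addn0.
rewrite -addSnnS; apply: IH => // l; have := eql l.
by rewrite eq_j => /addrI.
Qed.

Lemma layerE C u j l :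
  layer C u j l =
  \sum_(i < nmeas C | u (j + i)%N && ((nth (meas_dflt n) (meas C) i).2 == l.+1))
     (nth (meas_dflt n) (meas C) i).1.2.
Proof.
rewrite big_mkcond /=; elim: C j => [|[U T k|s p k] C IH] j /=; first by rewrite big_ord0.
  exact: IH.
rewrite /nmeas /= big_ord_recl addn0 andbC IH; congr (_ + _).
by apply: eq_bigr => i _; rewrite addSnnS.
Qed.

End Circuits.

(** * Outcome code and spacetime code *)

Lemma obitE m (u : 'rV['F_2]_m) (i : 'I_m) : obit u i = (u 0 i != 0).
Proof. by rewrite /obit (nth_map i) ?size_enum_ord // nth_ord_enum. Qed.

Lemma F2_neq0D (x y : 'F_2) : (x + y != 0) = (x != 0) (+) (y != 0).
Proof. by case: x y => [[|[|?]] ?] [[|[|?]] ?]. Qed.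

Lemma F2_neq0M (x y : 'F_2) : (x * y != 0) = (x != 0) && (y != 0).
Proof. by case: x y => [[|[|?]] ?] [[|[|?]] ?]. Qed.

Lemma F2_neq0_inj : injective (fun x : 'F_2 => x != 0).
Proof. by case=> [[|[|?]] ?] [[|[|?]] ?] //= _; apply: val_inj. Qed.

Lemma obitD m (u v : 'rV['F_2]_m) : obit (u + v) = (fun i => obit u i (+) obit v i).
Proof.
apply: funext => i; case: (ltnP i m) => [ltim|lemi].
  by rewrite !(obitE _ (Ordinal ltim)) mxE F2_neq0D.
by rewrite /obit !nth_default // size_map size_enum_ord.
Qed.

Section OutcomeCode.
Variables (n : nat) (C : seq (op n)).
Implicit Types (u v : 'rV['F_2]_(nmeas C)) (w : nat -> bool).

(** A nonzero entry in column [j] makes the basis state [j] an input with positive outcome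
    probability. *)
Lemma mem_outcome_code (o : 'rV['F_2]_(nmeas C)) : run C (obit o) 0 != 0 -> o \in outcome_code C.
Proof.
move=> nz; have [i [j nzij]] : exists i j, run C (obit o) 0 i j != 0.
  apply: contrapT => /forallNP all0; case/eqP: nz; apply/matrixP => i j.
  by rewrite mxE; apply/eqP; apply: contrapT => /negP nzij; apply: (all0 i); exists j.
rewrite inE; apply/asboolP; exists (delta_mx j 0); split.
  rewrite (bigD1 j) //= big1 ?addr0 => [|k /negPf nkj].
    by rewrite mxE !eqxx normr1 expr1n.
  by rewrite mxE nkj normr0 expr0n.
rewrite /outcome_prob psumr_neq0 => [|k _]; last by rewrite exprn_ge0.
apply/hasP; exists i; rewrite ?mem_index_enum //= exprn_gt0 // normr_gt0.
by rewrite -colE mxE.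
Qed.

Lemma parity_dual_code u w : u \in dual_code (outcome_code C) -> run C w 0 != 0 ->
  parity C (obit u) w 0 = false.
Proof.
rewrite inE => /forall_inP dual_u nz.
pose o : 'rV['F_2]_(nmeas C) := \row_i (w i)%:R.
have obit_o i : (i < nmeas C)%N -> obit o i = w i.
  by move=> lti; rewrite (obitE o (Ordinal lti)) mxE /=; case: (w i).
have /dual_u/eqP/matrixP/(_ 0 0) : o \in outcome_code C.
  by apply: mem_outcome_code; rewrite (@eq_run _ _ _ w).
rewrite !mxE => /(congr1 (fun x => x != 0)).
rewrite (big_morph (fun x : 'F_2 => x != 0 : bool) (id1 := false) (op1 := addb) F2_neq0D) //.
rewrite eqxx /= => <-; rewrite parityE; apply: eq_bigr => i _.
by rewrite F2_neq0M add0n obitE [in RHS]mxE -[o 0 i != 0]obitE obit_o.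
Qed.

(** Every possible outcome string is orthogonal to [u], so with A = 1 the weighted sum is the
    identity, which is nonzero. *)
Lemma meas_commute_dual_code u : circuit_ok C -> u \in dual_code (outcome_code C) ->
  meas_commute C (obit u) 0.
Proof.
move=> okC dual_u; suff h1 : heis C (obit u) 0 = 1%:M.
  have [] // := @heis_backprop n C (obit u) 0 okC.
  by rewrite h1 -(pmx0 'I_n) -[pmx _]scale1r scalar_neq0 oner_neq0.
rewrite -[LHS]mulmx1 (@heis_parity _ _ _ _ _ false) ?scale1r // => o.
by rewrite mulmx1; exact: parity_dual_code.
Qed.

Lemma meas_level_gt0 : circuit_ok C -> all (fun x => 0 < x.2)%N (meas C).
Proof.
elim: C => [|[U T l|s p l] C' IH] //=; first by case=> _ _ _ _ /IH.
by case=> _ -> _ _ /IH.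
Qed.

Lemma level_le_depth : all (fun o => (op_level o <= depth C)%N) C.
Proof.
rewrite /depth; elim: C => [|o C' IH] //=; rewrite big_cons leq_maxl.
by apply: sub_all IH => o' /leq_trans; apply; exact: leq_maxr.
Qed.

Lemma fault_ofE u (l : 'I_(depth C).+1) : circuit_ok C ->
  fault_of u l = layer C (obit u) 0 l.
Proof.
move=> /meas_level_gt0 lev0; rewrite ffunE layerE; apply: eq_bigl => i.
rewrite obitE; congr (_ && _); have := all_nthP (meas_dflt n) lev0 i (ltn_ord i).
by case: (_.2).
Qed.

Lemma back_cumulantE u (l : 'I_(depth C).+1) : circuit_ok C ->
  back_cumulant (fault_of u) l = backprop C (obit u) 0 l.
Proof.
move=> okC; rewrite ffunE; set F := (fun k : nat => _).
have FE k : (k <= depth C)%N -> F k = layer C (obit u) 0 k.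
  move=> lek; have ltk : (k < (depth C).+1)%N by [].
  by rewrite /F insubT (fault_ofE u (Ordinal ltk)).
have: (depth C - l + l = depth C)%N by rewrite subnK // -ltnS.
move: (nat_of_ord l) (depth C - l)%N => k d; elim: d k => [|d IH] k /=.
  (* At the last index, [depth C], both sides vanish: no operation has a level above the depth. *)
  rewrite add0n => ->; rewrite FE // layer_low ?level_le_depth //.
  by rewrite backprop_low ?level_le_depth.
move=> dk; rewrite pmulE FE ?IH -?backprop_step // ?addnS //.
by rewrite -dk leq_addl.
Qed.

Definition spacetime_gen w : pauli (st_qubits C) :=
  ([ffun x : st_qubits C => (backprop C w 0 x.1).1 x.2],
   [ffun x : st_qubits C => (backprop C w 0 x.1).2 x.2]).

Lemma spacetime_stabE : circuit_ok C ->
  spacetime_stab C = [set spacetime_gen (obit u) | u in dual_code (outcome_code C)].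
Proof.
move=> okC; apply: eq_imset => u; congr (_, _); apply/ffunP => x;
  by rewrite [LHS]ffunE back_cumulantE // ffunE.
Qed.

Lemma spacetime_genD u v : circuit_ok C ->
  spacetime_gen (obit (u + v)) = spacetime_gen (obit u) + spacetime_gen (obit v).
Proof.
by move=> okC; rewrite obitD; congr (_, _); apply/ffunP => x; rewrite !ffunE backpropD // !ffunE.
Qed.

Lemma symp_spacetime_gen w w' : symp (spacetime_gen w) (spacetime_gen w') =
  \sum_(l < (depth C).+1) symp (backprop C w 0 l) (backprop C w' 0 l).
Proof.
rewrite sympE; under [RHS]eq_bigr do rewrite sympE.
rewrite pair_bigA; apply: eq_bigr => x _; by rewrite !ffunE.
Qed.

(** By [backprop_step], the back-cumulant at two consecutive levels determines the layer between
    them, and the layers determine [u]. *)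
Lemma spacetime_gen_inj : circuit_ok C -> injective (fun u => spacetime_gen (obit u)).
Proof.
move=> okC u v [/ffunP eq1 /ffunP eq2].
have eqb l : backprop C (obit u) 0 l = backprop C (obit v) 0 l.
  case: (ltnP l (depth C).+1) => [ltl|/ltnW lel].
    rewrite [LHS]surjective_pairing [RHS]surjective_pairing.
    congr (_, _); apply/ffunP => x.
      by have := eq1 (Ordinal ltl, x); rewrite !ffunE.
    by have := eq2 (Ordinal ltl, x); rewrite !ffunE.
  have low : all (fun o => op_level o <= l)%N C.
    by apply: sub_all level_le_depth => o /leq_trans; apply.
  by rewrite !backprop_low.
have eql l : layer C (obit u) 0 l = layer C (obit v) 0 l.
  by have := eqb l; rewrite !(backprop_step _ _ l) // eqb => /addIr.
apply/rowP => i; apply: F2_neq0_inj; rewrite -!obitE.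
by have := layer_inj okC eql (ltn_ord i); rewrite add0n.
Qed.

(** The dual code is the kernel of the transpose of V, whose dimension is given by rank-nullity. *)
Lemma card_dual_code (V : 'M['F_2]_(nmeas C)) : outcome_code C = [set o | (o <= V)%MS] ->
  #|dual_code (outcome_code C)| = (2 ^ (nmeas C - \rank V))%N.
Proof.
move=> ->; have -> : dual_code [set o | (o <= V)%MS] = rowg (kermx V^T).
  apply/setP => u; rewrite !inE sub_kermx; apply/forall_inP/eqP => [dual_u|uV0 o].
    apply: trmx_inj; apply/row_matrixP => i.
    rewrite trmx_mul trmxK row_mul trmx0 row0; apply: trmx_inj.
    by rewrite trmx_mul trmxK trmx0; apply/eqP/dual_u; rewrite inE row_sub.
  by rewrite inE => /submxP[D ->]; rewrite trmx_mul mulmxA uV0 mul0mx.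
by rewrite card_rowg card_Fp // mxrank_ker mxrank_tr.
Qed.

End OutcomeCode.

Theorem mainTheorem3 (n : nat) (C : seq (op n)) (k : nat) :
  wf_circuit C ->
  (exists V : 'M['F_2]_(nmeas C),
      \rank V = k /\ outcome_code C = [set o | (o <= V)%MS]) ->
  let G := spacetime_stab C in
  [/\ pid _ \in G,
      (forall g h, g \in G -> h \in G -> pmul g h \in G),
      (forall g h, g \in G -> h \in G -> pcommute g h),
      (exists sg, stab_signs G sg) &
      (forall sg, stab_signs G sg ->
         code_dim G sg = (2 ^ (n * (depth C).+1 - (nmeas C - k)))%N)].
Proof.
move=> /wf_circuit_ok okC [V [rkV codeE]] G.
have GE : G = _ := spacetime_stabE okC.
set D := dual_code _ in GE.
have D0 : 0 \in D by rewrite inE; apply/forall_inP => o _; rewrite mul0mx.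
have DD u v : u \in D -> v \in D -> u + v \in D.
  rewrite !inE => /forall_inP uD /forall_inP vD; apply/forall_inP => o oC.
  by rewrite mulmxDl (eqP (uD o oC)) (eqP (vD o oC)) addr0.
have GD : {in G &, forall g h : pauli (st_qubits C), g + h \in G}.
  move=> g h; rewrite GE => /imsetP[u uD ->] /imsetP[v vD ->].
  by rewrite -spacetime_genD //; apply: imset_f; exact: DD.
have G0 : 0 \in G.
  have: spacetime_gen C (obit (0 : 'rV_(nmeas C))) \in G by rewrite GE imset_f.
  by move=> gG; have := GD _ _ gG gG; rewrite pauli_addpp.
have Gcomm : {in G &, forall g h, pcommute g h}.
  move=> g h; rewrite GE pcommuteE => /imsetP[u uD ->] /imsetP[v vD ->].
  rewrite symp_spacetime_gen big1 // => l _.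
  by apply: symp_backprop => //; exact: meas_commute_dual_code.
split=> //; first exact: exists_stab_signs.
move=> sg sgG; have := code_dim_stab G0 sgG.
have -> : #|G| = (2 ^ (nmeas C - k))%N.
  by rewrite GE card_imset; [rewrite (card_dual_code codeE) rkV | exact: spacetime_gen_inj].
rewrite /qdim card_prod !card_ord mulnC [(_ * n)%N]mulnC => dimE.
(* The group order divides the dimension of the Hilbert space, so the natural-number subtraction in
   the exponent does not truncate. *)
have le_N : (nmeas C - k <= n * (depth C).+1)%N.
  by rewrite -(dvdn_Pexp2l _ _ (ltnSn 1)) -dimE dvdn_mull.
apply/eqP; rewrite -(eqn_pmul2r (m := 2 ^ (nmeas C - k))) ?expn_gt0 // dimE.
by rewrite -expnD subnK.
Qed.
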